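(* Let $E$ be a linearly ordered (Hausdorff) topological semilattice. Then $E$ is $H$-closed if and only if all of the following conditions hold: (i) $E$ is complete, i.e. every non-empty subset of $E$ has an infimum and a supremum in $E$; (ii) for every $x\in E$ and every non-empty $A\subseteq E$ with $A={\downarrow}A\setminus\{x\}$ and $x=\sup A$, one has $x\in\operatorname{cl}_E(A)$; (iii) for every $x\in E$ and every non-empty $B\subseteq E$ with $B={\uparrow}B\setminus\{x\}$ and $x=\inf B$, one has $x\in\operatorname{cl}_E(B)$.
   Context: All topological spaces are assumed to be Hausdorff. A topological semigroup is a (Hausdorff) topological space with a (jointly) continuous semigroup operation. A semilattice is a semigroup whose operation is commutative and idempotent; a topological semilattice is a topological semigroup which is algebraically a semilattice. The natural order on a semilattice $E$ is: $e\leqslant f$ iff $ef=fe=e$. $E$ is linearly ordered if its natural order is linear (total). All infima and suprema are with respect to the natural order. For $e\in E$, ${\downarrow}e=\{f\in E\mid f\leqslant e\}$ and ${\uparrow}e=\{f\in E\mid e\leqslant f\}$; for $A\subseteq E$, ${\downarrow}A=\bigcup_{a\in A}{\downarrow}a$ and ${\uparrow}A=\bigcup_{a\in A}{\uparrow}a$. $\operatorname{cl}_E(A)$ denotes the closure of $A$ in $E$. A topological semigroup $S$ is $H$-closed if $S$ is a closed subset of every (Hausdorff) topological semigroup $T$ which contains $S$ both as a subsemigroup and as a topological subspace. *)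

(* Defs.v *)
From HB Require Import structures.
From mathcomp Require Import all_boot all_order.
From mathcomp Require Import all_classical.
From mathcomp Require Import topology.

Set Implicit Arguments.
Unset Strict Implicit.
Unset Printing Implicit Defensive.

Local Open Scope group_scope.
Local Open Scope classical_set_scope.

HB.mixin Record Semigroup_isTopologicalSemigroup S
    of Topological S & Semigroup S := {
  mulg_continuous : continuous (fun p : S * S => (p.1 * p.2 : S)) ;
}.

(* The Hausdorff axiom is not part of the structure; it is assumed separately
   through [hausdorff_space]. *)
#[short(type="topologicalSemigroupType")]
HB.structure Definition TopologicalSemigroup :=
  {S of Topological S & Semigroup S & Semigroup_isTopologicalSemigroup S}.

HB.mixin Record Semigroup_isSemilattice E of Semigroup E := {
  semilattice_mulC : commutative (@mul E) ;
  semilattice_mulxx : idempotent_op (@mul E) ;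
}.

#[short(type="semilatticeType")]
HB.structure Definition Semilattice :=
  {E of Semigroup E & Semigroup_isSemilattice E}.

#[short(type="topologicalSemilatticeType")]
HB.structure Definition TopologicalSemilattice :=
  {E of TopologicalSemigroup E & Semilattice E}.

(* [natural E] is [E] as a partially ordered set under its natural order:
   x <= y iff x * y = y * x = x. *)
Definition natural (E : semilatticeType) : Type := E.

Fact natural_display : Order.disp_t. Proof. exact: (Order.Disp tt tt). Qed.

Section NaturalOrder.
Variable E : semilatticeType.

Definition natural_le (x y : E) : bool := (x * y == x) && (y * x == x).

Lemma natural_le_refl : reflexive natural_le.
Proof. by move=> x; rewrite /natural_le !semilattice_mulxx eqxx. Qed.

Lemma natural_le_anti : antisymmetric natural_le.
Proof.
by move=> x y /andP[/andP[/eqP xy _] /andP[_ /eqP xy']]; rewrite -xy xy'.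
Qed.

Lemma natural_le_trans : transitive natural_le.
Proof.
move=> y x z /andP[/eqP xy /eqP yx] /andP[/eqP yz /eqP zy].
apply/andP; split; apply/eqP.
- by rewrite -xy -mulgA yz.
- by rewrite -yx mulgA zy.
Qed.

HB.instance Definition _ := Choice.on (natural E).
HB.instance Definition _ := @Order.Le_isPOrder.Build natural_display
  (natural E) natural_le natural_le_refl natural_le_anti natural_le_trans.

End NaturalOrder.

(* Dual of [down]. *)
Definition up d (T : porderType d) (A : set T) : set T :=
  [set x | exists y, A y /\ (y <= x)%O].

Definition topological_embedding (S T : topologicalType) (i : S -> T) : Prop :=
  injective i /\
  forall U : set S, open U <-> open (U : set (initial_topology i)).

(* "T contains S both as a subsemigroup and as a topological subspace" is
   expressed by a multiplicative topological embedding of S into T. *)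
Definition H_closed (S : topologicalSemigroupType) : Prop :=
  forall (T : topologicalSemigroupType) (i : S -> T),
    hausdorff_space T -> {morph i : x y / x * y} -> topological_embedding i ->
    closed (range i).

(* Main.v *)
From HB Require Import structures.
Require Import Defs.
From mathcomp Require Import all_boot all_order.
From mathcomp Require Import all_classical.
From mathcomp Require Import topology.

Set Implicit Arguments.
Unset Strict Implicit.
Unset Printing Implicit Defensive.

Import Order.TTheory.

Local Open Scope classical_set_scope.

(** Why the theorem holds. In a linearly ordered semilattice the product is the
minimum, and in a Hausdorff topological semilattice the rays [y <= x] and
[x <= y] are equalizers of continuous maps, hence closed
([closed_le], [closed_ge]).

The three conditions, in the order of the statement, are called (i), (ii) and
(iii) here.

The conditions are sufficient. Suppose that [E] sits in a Hausdorff semigroup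
[T], and let [z] be in the closure of [E]. By continuity [z] commutes with every
[e] in [E], and [e z] is [e] or [z]; so [z] cuts [E] into the down-set
[A = {e | e z = e}] and its complement [B], on which [e z = z]. The point [z] is
adherent to [A] or to [B]. If it is adherent to [A], let [s = sup A]. If [s] is
in [A], then [s z = s], whereas [s a = a] on [A] gives [s z = z]; if [s] is not
in [A], then [s z = z], whereas [s] is adherent to [A] by (ii) and [a z = a] on
[A] gives [s z = s]. In both cases [z = s] is in [E]. If [z] is adherent to [B],
the same argument applies to [inf B] and (iii) ([complete_closed_range]).

The conditions are necessary. Let [L] be a non-empty closed down-set without
maximum. Then [L] is also open, being a union of open rays, and a new point can
be inserted between [L] and its complement, with the sets [{y in L | a < y}], for
[a] in [L], as traces of its neighbourhoods. This gives a Hausdorff topological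
semigroup in which [E] is dense and different from the whole space, so [E] is not H-closed
([cut_not_H_closed]). Hence in an H-closed [E] every non-empty closed down-set
has a maximum, and dually ([H_closed_lower_max], [H_closed_upper_min]). The
closure of [down A] is a down-set, and its maximum is the supremum of [A]: so
[sup A] exists and is adherent to [down A] ([H_closed_sup]), which yields (i) and
(ii); (iii) is dual ([H_closed_inf]). *)

(** * Closed sets given by equations *)

Section ClosedEqualizers.
Local Open Scope group_scope.

Lemma closure_subset_closed (T : topologicalType) (A C : set T) :
  closed C -> A `<=` C -> closure A `<=` C.
Proof. by move=> /closure_id {2}-> ; exact: closureS. Qed.

Lemma closed_equalizer (S T : topologicalType) (f g : S -> T) :
  hausdorff_space T -> continuous f -> continuous g ->
  closed [set x | f x = g x].
Proof.
move=> hT cf cg x clx; apply: hT => U V fU gV.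
have /clx[y [fg [Uy Vy]]] : nbhs x (f @^-1` U `&` g @^-1` V).
  by apply: filterI; [exact: cf | exact: cg].
by exists (f y); split=> //; rewrite fg.
Qed.

Lemma continuous_mulgl (S : topologicalSemigroupType) (a : S) :
  continuous (fun x : S => a * x).
Proof.
move=> x; apply: (@continuous_comp _ _ _ (fun x => (a, x))
  (fun p => p.1 * p.2)).
  by apply: cvg_pair; [exact: cvg_cst | exact: cvg_id].
exact: mulg_continuous.
Qed.

Lemma continuous_mulgr (S : topologicalSemigroupType) (a : S) :
  continuous (fun x : S => x * a).
Proof.
move=> x; apply: (@continuous_comp _ _ _ (fun x => (x, a))
  (fun p => p.1 * p.2)).
  by apply: cvg_pair; [exact: cvg_id | exact: cvg_cst].
exact: mulg_continuous.
Qed.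

End ClosedEqualizers.

(** * Order-theoretic facts and the natural order *)

(** The condition [A = down A `\ x] in the theorem says, when [x] bounds [A], that
[A] is a down-set that does not contain [x]. *)
Lemma down_punctured_id d (P : porderType d) (x : P) (A : set P) :
  A = down A `\ x -> ubound A x -> down A = A.
Proof.
move=> AE ubx; apply/seteqP; split=> [y dAy|y Ay]; last by exists y.
rewrite AE; split=> // yx; case: dAy => z [Az yz].
have zx : z = x by apply/le_anti; rewrite ubx// -yx yz.
by move: Az; rewrite AE zx => -[_]; exact.
Qed.

Lemma up_punctured_id d (P : porderType d) (x : P) (B : set P) :
  B = up B `\ x -> lbound B x -> up B = B.
Proof.
move=> BE lbx; apply/seteqP; split=> [y uBy|y By]; last by exists y.
rewrite BE; split=> // yx; case: uBy => z [Bz zy].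
have zx : z = x by apply/le_anti; rewrite lbx// -yx zy.
by move: Bz; rewrite BE zx => -[_]; exact.
Qed.

Section NaturalOrder.
Local Open Scope group_scope.

Section Semilattice.
Variable E : semilatticeType.
Implicit Types x y : natural E.

Lemma natural_leP x y : reflect (x * y = x :> E) (x <= y)%O.
Proof.
apply: (iffP andP) => [[/eqP]//|xy]; split; apply/eqP => //.
by rewrite semilattice_mulC.
Qed.

Hypothesis linE : total (fun x y : natural E => (x <= y)%O).

Lemma natural_ltNge x y : (x < y)%O = ~~ (y <= x)%O.
Proof.
apply/idP/idP => [|nyx]; first by rewrite lt_leAnge => /andP[].
by rewrite lt_leAnge nyx andbT; case/orP: (linE x y) nyx => // ->.
Qed.

Lemma natural_leNgt x y : (x <= y)%O = ~~ (y < x)%O.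
Proof. by rewrite natural_ltNge negbK. Qed.

Lemma natural_mul_cases x y : (x * y : E) = x \/ (x * y : E) = y.
Proof.
case/orP: (linE x y) => /natural_leP; first by left.
by rewrite semilattice_mulC; right.
Qed.

End Semilattice.

Section TopologicalSemilattice.
Variable E : topologicalSemilatticeType.
Hypothesis hausE : hausdorff_space E.
Implicit Types x : natural E.

Lemma closed_le x : closed [set y : E | ((y : natural E) <= x)%O].
Proof.
rewrite (_ : mkset _ = [set y : E | y * x = y]); last first.
  by apply/seteqP; split=> y /natural_leP.
apply: closed_equalizer => //; first exact: continuous_mulgr.
by move=> y; exact: cvg_id.
Qed.

Lemma closed_ge x : closed [set y : E | (x <= y :> natural E)%O].
Proof.
rewrite (_ : mkset _ = [set y : E | x * y = x]); last first.
  by apply/seteqP; split=> y /natural_leP.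
apply: closed_equalizer => //; first exact: continuous_mulgl.
by move=> y; exact: cvg_cst.
Qed.

Hypothesis linE : total (fun x y : natural E => (x <= y)%O).

Lemma open_lt x : open [set y : E | (y < x :> natural E)%O].
Proof.
rewrite -closedC (_ : ~` _ = [set y : E | (x <= y :> natural E)%O]).
  exact: closed_ge.
by apply/seteqP; split=> y /=; rewrite (natural_leNgt linE) => /negP.
Qed.

Lemma open_gt x : open [set y : E | (x < y :> natural E)%O].
Proof.
rewrite -closedC (_ : ~` _ = [set y : E | (y <= x :> natural E)%O]).
  exact: closed_le.
by apply/seteqP; split=> y /=; rewrite (natural_leNgt linE) => /negP.
Qed.

End TopologicalSemilattice.
End NaturalOrder.

(** * Inserting a point into a cut *)

(** A place in the linearly ordered semilattice [E] where a new point can be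
inserted: [cut_lower] is the set of elements that will lie below the new point,
and [cut_germs] is the filter of the traces on [E] of its neighbourhoods. The
fields [cut_below] and [cut_above] say that near the new point one is, uniformly
near each [e] in [E], strictly above [e] if [e] is in [cut_lower] and strictly
below [e] otherwise; they also say that both sides of the cut are open. *)
Record cut (E : topologicalSemilatticeType) := Cut {
  cut_total : total (fun x y : natural E => (x <= y)%O);
  cut_lower : set E;
  cut_germs : set_system E;
  cut_proper : ProperFilter cut_germs;
  cut_open : forall W, cut_germs W -> cut_germs W^°;
  cut_below : forall e, cut_lower e ->
    \forall y \near cut_germs & e' \near e,
      cut_lower e' /\ (e' < y :> natural E)%O;
  cut_above : forall e, ~ cut_lower e ->
    \forall y \near cut_germs & e' \near e,
      ~ cut_lower e' /\ (y < e' :> natural E)%O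
}.

(** [E] with one more point [None], placed in the cut [c]. *)
Definition cut_extension (E : topologicalSemilatticeType) (c : cut E) : Type :=
  option E.

Section Extension.
Local Open Scope group_scope.
Variables (E : topologicalSemilatticeType) (c : cut E).
Local Notation L := (cut_lower c).
Local Notation F := (cut_germs c).
Local Notation T := (cut_extension c).
Implicit Types (a b : E).

#[local] Instance cut_germs_proper : ProperFilter F := cut_proper c.

(** The lower part of a cut lies below the upper part, because points near the
cut lie between them. *)
Lemma cut_mul a b : L a -> ~ L b -> a * b = a.
Proof.
move=> La nLb; apply/natural_leP.
have [[P P'] /= [FP aP'] PP'] := cut_below La.
have [[Q Q'] /= [FQ bQ'] QQ'] := cut_above nLb.
have [y [Py Qy]] := filter_ex (filterI FP FQ).
have [_ /= ay] := PP' (y, a) (conj Py (nbhs_singleton aP')).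
have [_ /= yb] := QQ' (y, b) (conj Qy (nbhs_singleton bQ')).
exact/ltW/(lt_trans ay).
Qed.

Lemma cut_mulC a b : L a -> ~ L b -> b * a = a.
Proof. by rewrite semilattice_mulC; exact: cut_mul. Qed.

Lemma cut_lower_mul a b : L (a * b) <-> L a \/ L b.
Proof.
have [La|nLa] := pselect (L a); have [Lb|nLb] := pselect (L b);
  rewrite ?(cut_mul La nLb) ?(cut_mulC Lb nLa); try tauto;
  by case: (natural_mul_cases (cut_total c) a b) => ->; tauto.
Qed.

(** The minimum for the order in which [None] is just above [cut_lower c]. *)
Definition cut_extension_mul (x y : T) : T :=
  match x, y with
  | Some a, Some b => Some (a * b)
  | Some a, None | None, Some a => if `[< L a >] then Some a else None
  | None, None => None
  end.

Lemma cut_extension_mulA : associative cut_extension_mul.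
Proof.
have DM a b : `[< L (a * b) >] = `[< L a >] || `[< L b >].
  by rewrite -asbool_or; exact/asbool_equiv_eq/cut_lower_mul.
have mulLU a b : `[< L a >] = true -> `[< L b >] = false -> a * b = a.
  by move=> /asboolP La /asboolP nLb; exact: cut_mul.
have mulUL a b : `[< L a >] = false -> `[< L b >] = true -> a * b = b.
  by rewrite semilattice_mulC => /mulLU/[apply].
case=> [x|] [y|] [z|] //=; first by rewrite mulgA.
- case Lx: `[< L x >]; case Ly: `[< L y >]; rewrite /= DM Lx ?Ly//=.
  by rewrite mulLU.
- case Lx: `[< L x >]; case Lz: `[< L z >]; rewrite /= ?Lx ?Lz//.
  + by rewrite mulLU.
  + by rewrite mulUL.
- by case Lx: `[< L x >]; rewrite /= ?Lx.
- case Ly: `[< L y >]; case Lz: `[< L z >]; rewrite /= DM Ly ?Lz//=.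
  by rewrite mulUL.
- by case Lz: `[< L z >]; rewrite /= ?Lz.
Qed.

Lemma cut_extension_mulC : commutative cut_extension_mul.
Proof. by case=> [x|] [y|] //=; rewrite semilattice_mulC. Qed.

(** [E] keeps its topology and is open in the extension; [cut_germs c] gives the
neighbourhoods of the new point. *)
Definition cut_extension_nbhs (x : T) : set_system T :=
  if x is Some a then [set A : set T | nbhs a (Some @^-1` A)]
  else [set A : set T | A None /\ F (Some @^-1` A)].

Let nbhs_proper x : ProperFilter (cut_extension_nbhs x).
Proof.
case: x => [a|]; first exact: fmap_proper_filter.
split; first by case.
split=> /=; first by split=> //; exact: filterT.
- by move=> A B [A0 FA] [B0 FB]; split=> //; exact: filterI.
- by move=> A B AB [A0 FA]; split; [exact: AB | apply: filterS FA => a; exact: AB].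
Qed.

Let nbhs_singl x A : cut_extension_nbhs x A -> A x.
Proof. by case: x => [a /nbhs_singleton|[]]. Qed.

Let nbhs_nbhs x A : cut_extension_nbhs x A ->
  cut_extension_nbhs x (cut_extension_nbhs^~ A).
Proof.
case: x => [a /= /nbhs_interior//|[A0 FA]]; split=> //=.
by move/cut_open: FA.
Qed.

HB.instance Definition _ := Choice.on T.
HB.instance Definition _ := isSemigroup.Build T cut_extension_mulA.
HB.instance Definition _ := hasNbhs.Build T cut_extension_nbhs.
HB.instance Definition _ := @Nbhs_isNbhsTopological.Build T
  nbhs_proper nbhs_singl nbhs_nbhs.

Let mul_continuous : continuous (fun p : T * T => (p.1 * p.2 : T)).
Proof.
have mulC : commutative (mul : T -> T -> T) := cut_extension_mulC.
(* Pairs of points of [E] are covered by the continuity of the product of [E], and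
   at [(None, None)] every neighbourhood is closed under products, because a
   product is one of its factors. By commutativity the pairs [(None, Some a)]
   remain: near such a pair the product is one of the two coordinates, always the
   same one. *)
have cNS a (A : set T) : nbhs ((None : T) * (Some a : T)) A ->
    \forall x \near (None : T) & y \near (Some a : T), A (x * y).
  rewrite {1}/mul /=; case: asboolP => [La aA|nLa [AN FA]].
    have [[P Q] /= [FP aQ] PQ] := cut_below La.
    exists ([set x | if x is Some b then P b else True],
            [set x | if x is Some b then Q b /\ A x else False]) => /=.
      by split=> //; exact: filterI.
    move=> [[x|] [b|]] [] //= Px [Qb Ab]; last first.
      by have [y Py] := filter_ex FP; have [/= Lb _] := PQ (_, b) (conj Py Qb);
        rewrite /mul /= asboolT.
    have [_ /= /ltW/natural_leP bx] := PQ (x, b) (conj Px Qb).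
    by rewrite mulC /mul /= bx.
  have [[P Q] /= [FP aQ] PQ] := cut_above nLa.
  exists ([set x | if x is Some b then P b /\ A x else True],
          [set x | if x is Some b then Q b else False]) => /=.
    by split=> //; split=> //; exact: filterI.
  move=> [[x|] [b|]] [] //= Px Qb; last first.
    by have [y Py] := filter_ex FP; have [/= Lb _] := PQ (_, b) (conj Py Qb);
      rewrite /mul /= asboolF.
  have [_ /= /ltW/natural_leP xb] := PQ (x, b) (conj Px.1 Qb).
  by rewrite /mul /= xb; case: Px.
case=> [[a|] [b|]] A /= nA.
- have [[P Q] /= [aP bQ] PQ] := @mulg_continuous E (a, b) _ nA.
  exists ([set x | if x is Some b then P b else False],
          [set x | if x is Some b then Q b else False]) => //=.
  by move=> [[x|] [y|]] [] //= Px Qy; exact: (PQ (x, y)).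
- rewrite mulC in nA; have [[P Q] /= [NP aQ] PQ] := cNS _ _ nA.
  by exists (Q, P) => //= -[x y] [Qx Py] /=; rewrite mulC; exact: (PQ (y, x)).
- exact: cNS.
- exists (A, A) => //= -[[x|] [y|]] [] //= Ax Ay; rewrite /mul /=.
  + by case: (natural_mul_cases (cut_total c) x y) => ->.
  + by case: ifP.
  + by case: ifP.
Qed.

HB.instance Definition _ := Semigroup_isTopologicalSemigroup.Build T
  mul_continuous.

Lemma cut_extension_hausdorff : hausdorff_space E -> hausdorff_space T.
Proof.
have sepNS a : ~ cluster (nbhs (None : T)) (Some a : T).
  have sep (P Q : set E) : F P -> nbhs a Q ->
      cluster (nbhs (None : T)) (Some a : T) -> exists y, P y /\ Q y.
    move=> FP aQ /(_ [set x | if x is Some b then P b else True]).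
    move=> /(_ [set x | if x is Some b then Q b else False] (conj I FP) aQ).
    by move=> -[[y|] []] // Py Qy; exists y.
  have [La|nLa] := pselect (L a).
    have [[P Q] /= [FP aQ] PQ] := cut_below La.
    move=> /(sep _ _ FP aQ)[y yPQ].
    by have [_ /=] := PQ (y, y) yPQ; rewrite ltxx.
  have [[P Q] /= [FP aQ] PQ] := cut_above nLa.
  move=> /(sep _ _ FP aQ)[y yPQ].
  by have [_ /=] := PQ (y, y) yPQ; rewrite ltxx.
move=> hE [a|] [b|] // ab; last by case: (sepNS b).
  congr Some; apply: hE => A B aA bB.
  have [] := ab [set x | if x is Some b then A b else False]
    [set x | if x is Some b then B b else False] aA bB.
  by case=> [y|] [] // Ay By; exists y.
case: (sepNS a) => A B NA aB; rewrite setIC; exact: ab.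
Qed.

Lemma cut_extension_embedding : topological_embedding (Some : E -> T).
Proof.
split; first by move=> x y [].
move=> U; split=> [oU|[V oV <-]].
  exists (Some @` U : set T).
    rewrite openE => _ [x Ux <-]; apply: filterS (open_nbhs_nbhs (conj oU Ux)).
    by move=> y Uy; exists y.
  by apply/seteqP; split=> [x [y Uy [<-]]//|x Ux]; exists x.
by rewrite openE => x /= Vx; exact: (open_nbhs_nbhs (conj oV Vx)).
Qed.

End Extension.

(** The new point is adherent to [E], as its filter of germs is proper. *)
Lemma cut_not_H_closed (E : topologicalSemilatticeType) (c : cut E) :
  hausdorff_space E -> ~ H_closed E.
Proof.
move=> hE /(_ (cut_extension c) Some (cut_extension_hausdorff hE)).
move=> /(_ (fun _ _ => erefl) (cut_extension_embedding c)) clE.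
have : closure (range (Some : E -> cut_extension c)) None.
  move=> A [_ FA]; have [y Ay] := @filter_ex _ _ (cut_proper c) _ FA.
  by exists (Some y); split=> //; exists y.
by move=> /clE[].
Qed.

(** * Suprema and infima in H-closed semilattices *)

Section CompletenessOfHClosed.
Variable E : topologicalSemilatticeType.
Hypothesis hausE : hausdorff_space E.
Hypothesis linE : total (fun x y : natural E => (x <= y)%O).
Hypothesis HE : H_closed E.

(** Otherwise the germs of [L] at its upper end define a cut. *)
Lemma H_closed_lower_max (L : set (natural E)) :
  L !=set0 -> closed (L : set E) -> L = down L ->
  exists2 m, L m & ubound L m.
Proof.
move=> L0 cL dL; apply: contrapT => nomax.
have dnL x y : (x <= y)%O -> L y -> L x by rewrite {2}dL => xy Ly; exists y.
have gtL x : L x -> exists2 y, L y & (x < y)%O.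
  move=> Lx; apply: contrapT => nx; apply: nomax; exists x => // y Ly.
  by rewrite (natural_leNgt linE); apply/negP => xy; apply: nx; exists y.
(* [L] has no maximum, so it is the union of the open rays [{x | x < y}] with [y]
   in [L]. *)
have oL : open (L : set E).
  rewrite openE => x /gtL[y Ly xy].
  apply: filterS (open_nbhs_nbhs (conj (open_lt hausE linE y) xy)).
  by move=> z /ltW zy; exact: dnL zy Ly.
pose B (x : natural E) := [set y : E | L y /\ (x < y :> natural E)%O].
have oB x : open (B x) by apply: openI => //; exact: open_gt.
pose F : set_system E := filter_from L B.
have FF : ProperFilter F.
  apply: filter_from_proper => [|x /gtL[y Ly xy]]; last by exists y.
  apply: filter_from_filter => // x y Lx Ly.
  case/orP: (linE x y) => xy; [exists y | exists x] => //.
    by move=> z [Lz yz]; split; split=> //; exact: le_lt_trans yz.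
  by move=> z [Lz yz]; split; split=> //; exact: le_lt_trans yz.
have Fo W : F W -> F W^°.
  by move=> [x Lx BW]; exists x => //; rewrite -open_subsetE.
have Fb (e : E) : L e -> \forall y \near F & e' \near e,
      L e' /\ (e' < y :> natural E)%O.
  move=> /gtL[b Lb eb].
  exists (B b, [set z : E | (z < b :> natural E)%O]) => /=.
    by split; [exists b | exact: open_nbhs_nbhs (conj (open_lt hausE linE b) eb)].
  move=> [y z] /= [[Ly yb] zb]; split; first exact: dnL (ltW zb) Lb.
  exact: lt_trans yb.
have Fa (e : E) : ~ L e -> \forall y \near F & e' \near e,
      ~ L e' /\ (y < e' :> natural E)%O.
  move=> nLe; have [a La] := L0; exists (L, ~` L) => /=.
    split; first by exists a => // y [].
    by apply: open_nbhs_nbhs; split=> //; exact: closed_openC.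
  move=> [y z] /= [Ly nLz]; split=> //.
  by rewrite (natural_ltNge linE); apply/negP => /dnL/(_ Ly).
exact: (cut_not_H_closed (Cut linE FF Fo Fb Fa) hausE HE).
Qed.

(** Otherwise the germs of [U] at its lower end define a cut, whose lower part is
the complement of [U]. *)
Lemma H_closed_upper_min (U : set (natural E)) :
  U !=set0 -> closed (U : set E) -> U = up U ->
  exists2 m, U m & lbound U m.
Proof.
move=> U0 cU uU; apply: contrapT => nomin.
have upU x y : (x <= y)%O -> U x -> U y by rewrite {2}uU => xy Ux; exists x.
have ltU x : U x -> exists2 y, U y & (y < x)%O.
  move=> Ux; apply: contrapT => nx; apply: nomin; exists x => // y Uy.
  by rewrite (natural_leNgt linE); apply/negP => xy; apply: nx; exists y.
have oU : open (U : set E).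
  rewrite openE => x /ltU[y Uy yx].
  apply: filterS (open_nbhs_nbhs (conj (open_gt hausE linE y) yx)).
  by move=> z /ltW yz; exact: upU yz Uy.
pose B (x : natural E) := [set y : E | U y /\ (y < x :> natural E)%O].
have oB x : open (B x) by apply: openI => //; exact: open_lt.
pose F : set_system E := filter_from U B.
have FF : ProperFilter F.
  apply: filter_from_proper => [|x /ltU[y Uy yx]]; last by exists y.
  apply: filter_from_filter => // x y Ux Uy.
  case/orP: (linE x y) => xy; [exists x | exists y] => //.
    by move=> z [Uz zx]; split; split=> //; exact: lt_le_trans zx _.
  by move=> z [Uz zx]; split; split=> //; exact: lt_le_trans zx _.
have Fo W : F W -> F W^°.
  by move=> [x Ux BW]; exists x => //; rewrite -open_subsetE.
have Fb (e : E) : (~` U) e -> \forall y \near F & e' \near e,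
      (~` U) e' /\ (e' < y :> natural E)%O.
  move=> nUe; have [a Ua] := U0; exists (U, ~` U) => /=.
    split; first by exists a => // y [].
    by apply: open_nbhs_nbhs; split=> //; exact: closed_openC.
  move=> [y z] /= [Uy nUz]; split=> //.
  by rewrite (natural_ltNge linE); apply/negP => /upU/(_ Uy).
have Fa (e : E) : ~ (~` U) e -> \forall y \near F & e' \near e,
      ~ (~` U) e' /\ (y < e' :> natural E)%O.
  move=> /contrapT/ltU[b Ub be].
  exists (B b, [set z : E | (b < z :> natural E)%O]) => /=.
    by split; [exists b | exact: open_nbhs_nbhs (conj (open_gt hausE linE b) be)].
  move=> [y z] /= [[Uy yb] bz]; split; last exact: lt_trans bz.
  by apply; exact: upU (ltW bz) Ub.
exact: (cut_not_H_closed (Cut linE FF Fo Fb Fa) hausE HE).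
Qed.

Lemma H_closed_sup (A : set (natural E)) : A !=set0 ->
  exists2 s, supremums A s & closure (down A : set E) s.
Proof.
move=> [a Aa]; have AdA : A `<=` down A by move=> x Ax; exists x.
have [|||s Ls sub] := @H_closed_lower_max (closure (down A : set E)).
- by exists a; apply/subset_closure/AdA.
- exact: closed_closure.
- apply/seteqP; split=> [x clx|x [y [cly xy]]]; first by exists x.
  (* A point below [y] but above all of [down A] can only be [y] itself. *)
  have [dAx|ndAx] := pselect (down A x); first exact: subset_closure.
  move: xy; rewrite le_eqVlt => /predU1P[-> //|xy].
  have /cly[z [[b [Ab zb]] /= xz]] :
      nbhs (y : E) [set z : E | (x < z :> natural E)%O].
    by apply: open_nbhs_nbhs; split=> //; exact: open_gt.
  by case: ndAx; exists b; split=> //; exact/ltW/(lt_le_trans xz).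
exists s => //; split=> [x Ax|u uA]; first by apply: sub; apply/subset_closure/AdA.
have dAu x : down A x -> (x <= u)%O by move=> [y [/uA yu xy]]; exact: le_trans yu.
exact: (closure_subset_closed (@closed_le _ hausE u) dAu Ls).
Qed.

Lemma H_closed_inf (A : set (natural E)) : A !=set0 ->
  exists2 s, infimums A s & closure (up A : set E) s.
Proof.
move=> [a Aa]; have AuA : A `<=` up A by move=> x Ax; exists x.
have [|||s Us slb] := @H_closed_upper_min (closure (up A : set E)).
- by exists a; apply/subset_closure/AuA.
- exact: closed_closure.
- apply/seteqP; split=> [x clx|x [y [cly yx]]]; first by exists x.
  have [uAx|nuAx] := pselect (up A x); first exact: subset_closure.
  move: yx; rewrite le_eqVlt => /predU1P[<- //|yx].
  have /cly[z [[b [Ab bz]] /= zx]] :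
      nbhs (y : E) [set z : E | (z < x :> natural E)%O].
    by apply: open_nbhs_nbhs; split=> //; exact: open_lt.
  by case: nuAx; exists b; split=> //; exact/ltW/(le_lt_trans bz).
exists s => //; split=> [x Ax|u uA]; first by apply: slb; apply/subset_closure/AuA.
have uAu x : up A x -> (u <= x)%O by move=> [y [/uA uy yx]]; exact: le_trans yx.
exact: (closure_subset_closed (@closed_ge _ hausE u) uAu Us).
Qed.

End CompletenessOfHClosed.

(** * Closedness of complete semilattices *)

Section ClosedRange.
Local Open Scope group_scope.
Variables (E : topologicalSemilatticeType) (T : topologicalSemigroupType).
Variable i : E -> T.
Hypothesis linE : total (fun x y : natural E => (x <= y)%O).
Hypothesis hausT : hausdorff_space T.
Hypothesis iM : {morph i : x y / x * y}.
Hypothesis i_cont : continuous i.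

Lemma closure_range_mulC (z : T) (e : E) :
  closure (range i) z -> i e * z = z * i e.
Proof.
apply: (@closure_subset_closed _ _ [set y | i e * y = y * i e]).
  by apply: closed_equalizer; [|exact: continuous_mulgl|exact: continuous_mulgr].
by move=> _ [f _ <-] /=; rewrite -!iM semilattice_mulC.
Qed.

Lemma closure_image_mulr (A : set E) (a z : T) :
  (forall x, A x -> a * i x = i x) -> closure (i @` A) z -> a * z = z.
Proof.
move=> aA; apply: (@closure_subset_closed _ _ [set y | a * y = y]).
  apply: closed_equalizer => //; first exact: continuous_mulgl.
  by move=> y; exact: cvg_id.
by move=> _ [x Ax <-]; exact: aA.
Qed.

Lemma closure_image_mul_cst (A : set E) (a b z : T) :
  (forall x, A x -> a * i x = b) -> closure (i @` A) z -> a * z = b.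
Proof.
move=> aA; apply: (@closure_subset_closed _ _ [set y | a * y = b]).
  apply: closed_equalizer => //; first exact: continuous_mulgl.
  by move=> y; exact: cvg_cst.
by move=> _ [x Ax <-]; exact: aA.
Qed.

Lemma closure_range_mul_cases (z : T) (e : E) :
  closure (range i) z -> i e * z = i e \/ i e * z = z.
Proof.
pose A := [set f : E | e * f = e].
rewrite -(setUv A) image_setU closureU => -[clz|clz]; [left|right].
  by apply: closure_image_mul_cst clz => f; rewrite -iM => ->.
apply: closure_image_mulr clz => f nAf.
by rewrite -iM; case: (natural_mul_cases linE e f) => [/nAf|->].
Qed.

Lemma image_closure (A : set E) x : closure A x -> closure (i @` A) (i x).
Proof.
move=> clA B /i_cont/clA[y [Ay By]]; exists (i y); split=> //; by exists y.
Qed.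

(** The hypotheses combine completeness with the conditions (ii) and (iii), the
latter for down-sets and up-sets that do not contain their bound. *)
Lemma complete_closed_range :
  (forall A : set (natural E), A !=set0 ->
     exists2 s, supremums A s & ~ A s -> A = down A -> closure (A : set E) s) ->
  (forall A : set (natural E), A !=set0 ->
     exists2 s, infimums A s & ~ A s -> A = up A -> closure (A : set E) s) ->
  closed (range i).
Proof.
move=> supE infE z clz.
pose A : set (natural E) := [set e | i e * z = i e].
have inA e : ~ A e -> i e * z = z by case: (closure_range_mul_cases e clz).
have dA x y : (x <= y)%O -> A y -> A x.
  by move=> /natural_leP <-; rewrite /A /= iM -mulgA => ->.
have : closure (i @` (A : set E) `|` i @` (~` A : set E)) z.
  by rewrite -image_setU setUv.
rewrite closureU => -[clAz|clBz].
- have A0 : A !=set0 by have [_ [[a Aa _] _]] := clAz _ filterT; exists a.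
  have [s [sub _] cls] := supE _ A0; exists s => //.
  have [As|nAs] := pselect (A s).
    rewrite -As; apply: closure_image_mulr clAz => a /sub/natural_leP.
    by rewrite -iM semilattice_mulC => ->.
  rewrite -[RHS](inA _ nAs) (closure_range_mulC _ clz); apply/esym.
  apply: closure_image_mulr (image_closure (cls nAs _)) => [a Aa|].
    by rewrite -(closure_range_mulC _ clz).
  by apply/seteqP; split=> [x Ax|x [y [Ay xy]]]; [exists x | exact: dA Ay].
- have B0 : ~` A !=set0 by have [_ [[a Aa _] _]] := clBz _ filterT; exists a.
  have [s [slb _] cls] := infE _ B0; exists s => //.
  have [As|nAs] := pselect (A s); last first.
    rewrite -[RHS](inA _ nAs); apply/esym.
    by apply: closure_image_mul_cst clBz => b /slb/natural_leP; rewrite -iM => ->.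
  rewrite -[LHS]As (closure_range_mulC _ clz).
  apply: closure_image_mul_cst (image_closure (cls _ _)) => // [b nAb|].
    by rewrite -(closure_range_mulC _ clz) inA.
  by apply/seteqP; split=> [x nAx|x [y [nAy yx]] /(dA _ _ yx)]; first by exists x.
Qed.

End ClosedRange.

Theorem theorem2 (E : topologicalSemilatticeType)
    (hausE : hausdorff_space E)
    (linE : total (fun x y : natural E => (x <= y)%O)) :
  H_closed E <->
  [/\ (forall A : set (natural E), A !=set0 ->
         (exists x, infimums A x) /\ (exists x, supremums A x)),
      (forall (x : natural E) (A : set (natural E)), A !=set0 ->
         A = down A `\ x -> supremums A x -> closure (A : set E) x) &
      (forall (x : natural E) (B : set (natural E)), B !=set0 ->
         B = up B `\ x -> infimums B x -> closure (B : set E) x)].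
Proof.
split=> [HE|[complE supE infE]].
- split.
  + move=> A A0; have [s ? _] := H_closed_inf hausE linE HE A0.
    by have [t ? _] := H_closed_sup hausE linE HE A0; split; [exists s|exists t].
  + move=> x A A0 AE supx; have [s sups] := H_closed_sup hausE linE HE A0.
    have -> : s = x.
      by apply/le_anti/andP; split; [exact/sups.2/supx.1|exact/supx.2/sups.1].
    by rewrite (down_punctured_id AE supx.1).
  + move=> x A A0 AE infx; have [s infs] := H_closed_inf hausE linE HE A0.
    have -> : s = x.
      by apply/le_anti/andP; split; [exact/infx.2/infs.1|exact/infs.2/infx.1].
    by rewrite (up_punctured_id AE infx.1).
- move=> T i hausT iM [_ iemb].
  have i_cont : continuous i.
    by apply/continuousP => V oV; apply/iemb; exists V.
  apply: (complete_closed_range linE hausT iM i_cont) => A A0.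
    have [_ [s sups]] := complE _ A0; exists s => // nAs AE; apply: supE => //.
    rewrite -AE; apply/seteqP; split=> [y Ay|y []//]; split=> // ys.
    by rewrite -ys in nAs.
  have [[s infs] _] := complE _ A0; exists s => // nAs AE; apply: infE => //.
  rewrite -AE; apply/seteqP; split=> [y Ay|y []//]; split=> // ys.
  by rewrite -ys in nAs.
Qed.
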